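(* Let $X$ be a locally compact Tychonoff space. Then $(B_1(X),\tau_{UC})$ is a strong Choquet space.
   Context: $\omega$ is the set of non-negative integers. $B_1(X)$ is the set of all functions $f:X\to\mathbb R$ that are pointwise limits of a sequence of continuous functions from $X$ to $\mathbb R$ (Baire 1 functions). $\tau_{UC}$ is the topology of uniform convergence on compact sets: a base of neighbourhoods of $f$ is given by the sets $W(f,K,\varepsilon)=\{g:\ |f(x)-g(x)|<\varepsilon \text{ for all } x\in K\}$, where $K\subset X$ is nonempty compact and $\varepsilon>0$. Strong Choquet game on a topological space $Z$: player $\beta$ starts by choosing a pair $(x_0,U_0)$ with $U_0\subset Z$ open and $x_0\in U_0$; player $\alpha$ answers with an open set $V_0\subset U_0$ with $x_0\in V_0$. In the $n$th move ($n\ge 1$), $\beta$ chooses $(x_n,U_n)$ with $U_n$ open, $x_n\in U_n\subset V_{n-1}$, and $\alpha$ answers with an open set $V_n\subset U_n$ with $x_n\in V_n$. Player $\alpha$ wins the play if $\bigcap_{n\in\omega}V_n\neq\emptyset$; otherwise $\beta$ wins. $Z$ is a strong Choquet space if $\alpha$ has a winning strategy in this game. *)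

(* Defs.v *)
From HB Require Import structures.
From mathcomp Require Import all_boot all_order all_algebra.
From mathcomp Require Import all_classical all_reals all_analysis.

Set Implicit Arguments.
Unset Strict Implicit.
Unset Printing Implicit Defensive.

Import Order.TTheory GRing.Theory Num.Theory.
Import numFieldNormedType.Exports.
Local Open Scope classical_set_scope.
Local Open Scope ring_scope.

Definition tychonoff_space (X : topologicalType) : Prop :=
  accessible_space X /\ completely_regular_space X.

(* [completely_regular_space] is phrased with uniformities; this is the usual
   form. *)
Lemma tychonoff_spaceP (R : realType) (X : topologicalType) :
  tychonoff_space X <->
  (forall x : X, closed [set x]) /\
  (forall (a : X) (B : set X), closed B -> ~ B a ->
    exists f : X -> R, [/\ continuous f, range f `<=` `[0, 1],
      f a = 0 & forall x, B x -> f x = 1]).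
Proof.
split=> -[T1 cr]; split.
- exact: accessible_closed_set1.
- move=> a B clB nBa.
  have /(@uniform_separatorP _ R)[f [cf f01 fa fB]] := cr a B clB nBa.
  exists f; split => // [|x Bx]; first by apply: fa; exists a.
  by apply: fB; exists x.
- move=> x y xy; exists (~` [set y]); split.
  + exact: closed_openC.
  + by rewrite inE /= => /eqP; apply/negP.
  + by rewrite setCK inE.
- move=> a B clB nBa; apply/(@uniform_separatorP _ R).
  have [f [cf f01 fa fB]] := cr a B clB nBa.
  by exists f; split => // _ [x + <-]; [move=> -> | exact: fB].
Qed.

Definition baire1 (X : topologicalType) (R : realType) : set (X -> R) :=
  [set f | exists2 u : nat -> X -> R, (forall n, continuous (u n)) &
           forall x, u n x @[n --> \oo] --> f x].

(* The library puts on [{family compact, X -> R}] the topology of uniform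
   convergence on compact sets, and on a set [A], seen as a type, the subspace
   topology. *)
Definition baire1_UC (X : topologicalType) (R : realType) : topologicalType :=
  set_type (@baire1 X R : set {family compact, X -> R}).

Lemma nbhs_family_compactP (X : topologicalType) (R : realType)
    (f : {family compact, X -> R}) (P : set {family compact, X -> R}) :
  nbhs f P <->
  exists (K : set X) (e : R), [/\ compact K, 0 < e &
    [set g : {family compact, X -> R} |
      forall x, K x -> `|f x - g x| < e] `<=` P].
Proof.
split=> [|[K [e [cK e0 sub]]]]; last first.
  apply: filterS sub _.
  have := @fam_nbhs _ _ _ K [set xy : R * R | ball xy.1 e xy.2] f.
  by apply => //; rewrite -entourage_ballE; exists e.
pose F : set_system (X -> R) := [set P | exists (K : set X) (e : R),
  [/\ compact K, 0 < e &
    [set g : X -> R | forall x, K x -> `|f x - g x| < e] `<=` P]].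
have FF : Filter F.
  split.
  - by exists set0, 1; split => //; exact: compact0.
  - move=> A B [K [e [cK e0 sP]]] [L [d [cL d0 sQ]]].
    exists (K `|` L), (Num.min e d); split; first exact: compactU.
      by rewrite lt_min e0.
    move=> g /= gfe; split.
      by apply: sP => x Kx; have := gfe x (or_introl Kx); rewrite lt_min => /andP[].
    by apply: sQ => x Lx; have := gfe x (or_intror Lx); rewrite lt_min => /andP[].
  - move=> A B AB [K [e [cK e0 sP]]]; exists K, e; split => //.
    exact: subset_trans AB.
suff : {family compact, F --> f} by apply.
apply/fam_cvgP => K cK Q /uniform_nbhs[E [entE subQ]].
move: entE; rewrite -entourage_ballE => -[e /= e0 eE].
exists K, e; split => // g gfe; apply: subQ => x Kx /=.
by apply: eE; exact: gfe.
Qed.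

Section StrongChoquetGame.
Variable Z : topologicalType.

(* The game has perfect information, so a strategy of alpha may be taken to
   depend on the moves of beta only: the previous answers of alpha can be
   recomputed from them. *)
Definition alpha_strategy : Type := seq (Z * set Z) -> set Z.

Implicit Types (s : alpha_strategy) (b : nat -> Z * set Z).

(* V_n, when beta plays (x_n, U_n) = b n *)
Definition alpha_answer s b (n : nat) : set Z := s (mkseq b n.+1).

Definition beta_legal s b (n : nat) : Prop :=
  [/\ open (b n).2, (b n).2 (b n).1 &
      forall m, n = m.+1 -> (b n).2 `<=` alpha_answer s b m].

Definition alpha_legal s b (n : nat) : Prop :=
  [/\ open (alpha_answer s b n), alpha_answer s b n (b n).1 &
      alpha_answer s b n `<=` (b n).2].

Definition alpha_winning s : Prop :=
  forall b,
    (forall n, (forall k, (k <= n)%N -> beta_legal s b k) -> alpha_legal s b n)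
    /\ ((forall n, beta_legal s b n) -> \bigcap_n alpha_answer s b n !=set0).

Definition strong_choquet : Prop := exists s, alpha_winning s.

End StrongChoquetGame.

(* Main.v *)
Require Import Defs.
From mathcomp Require Import all_boot all_order all_algebra.
From mathcomp Require Import all_classical all_reals all_analysis.
From mathcomp Require Import lra ring.

Set Implicit Arguments.
Unset Strict Implicit.
Unset Printing Implicit Defensive.

Import Order.TTheory GRing.Theory Num.Theory.
Import numFieldNormedType.Exports.
Local Open Scope classical_set_scope.
Local Open Scope ring_scope.
(** Player alpha wins by forcing beta's functions f_n to converge uniformly on
    each set K_n of a growing sequence of compact sets, whose union Y is the union of the
    cozero sets of a sequence of bump functions.

    Given beta's move (f_n, U_n), alpha takes a basic neighbourhood of f_n
    inside U_n, given by a compact set L_n and a radius e_n, lets K_(n+1) be the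
    union of L_n and of a compact set containing the support of a continuous
    bump chi_n that is 1 on K_n ([compact_bump], which combines local
    compactness with complete regularity), and answers with the interior of
    the functions at distance < eps_n from f_n on K_(n+1), where
    eps_n <= 2^-n and eps_n < e_n. All later functions of beta lie in this
    answer, so (f_n) is uniformly Cauchy on each K_m. If a Baire 1 function g
    on the whole of X is the pointwise limit of (f_n) on Y, then
    |f_n - g| <= eps_n < e_n on L_n, hence g lies in every U_n, and therefore
    in every answer of alpha.

    The substance is the existence of g ([baire1_glue]). Neither of the two
    classical facts, that a uniform limit of Baire 1 functions is Baire 1 and
    that Baire 1 functions can be patched along a partition of unity, applies
    directly: the convergence is uniform only on each K_m, and continuous
    functions u_(n,k) approximating f_n as k grows need not be close to
    each other when n varies. Both difficulties are settled at once by a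
    recursion on n ([glue]) producing continuous functions a_(n,k). Going from
    n to n+1, the increment is truncated at height 2^-n where chi_n is 1, and
    a_(n+1,k) is the product of u_(n+1,k) by the bump chi_(n+2)
    where chi_n is 0. As k grows, a_(n,k) tends to chi_(n+1) f_n, because the
    truncation does not affect the limit f_(n+1) - f_n. At a given point, the
    increments are bounded by 2^-n uniformly in k, from some n on, and this
    allows the diagonal a_(k,k) to converge to the limit in n of chi_(n+1) f_n
    ([cvg_diagonal]), which is the limit of (f_n) on Y and 0 elsewhere. *)

(** * Truncation *)

(** This is y truncated to the interval from -r to r. The formula by absolute
    values makes the continuity of the truncation that of the norm. *)
Definition clamp (R : realType) (r y : R) : R := (`|y + r| - `|y - r|) / 2.

Lemma norm_clamp_le (R : realType) (r y : R) : 0 <= r -> `|clamp r y| <= r.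
Proof.
move=> r0; rewrite /clamp ler_norml.
case: (ger0P (y + r)) => h1; case: (ger0P (y - r)) => h2.
all: by apply/andP; split; lra.
Qed.

Lemma clamp_id (R : realType) (r y : R) : `|y| <= r -> clamp r y = y.
Proof.
rewrite ler_norml => /andP[y1 y2]; rewrite /clamp.
have yr : 0 <= y + r by lra.
have ry : y - r <= 0 by lra.
by rewrite (ger0_norm yr) (ler0_norm ry); lra.
Qed.

Lemma clamp_ge (R : realType) (r y : R) : 0 <= r <= y -> clamp r y = r.
Proof.
move=> /andP[r0 ry]; rewrite /clamp.
have yr : 0 <= y + r by lra.
have ry' : 0 <= y - r by lra.
by rewrite (ger0_norm yr) (ger0_norm ry'); lra.
Qed.

Lemma cvg_clamp (R : realType) (T : Type) (F : set_system T) (FF : Filter F)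
    (r : R) (f : T -> R) (y : R) :
  f t @[t --> F] --> y -> clamp r (f t) @[t --> F] --> clamp r y.
Proof.
move=> fy; apply: cvgM; last exact: cvg_cst.
apply: cvgB; apply: cvg_norm; [apply: cvgD|apply: cvgB] => //.
all: exact: cvg_cst.
Qed.

(** * Diagonal limits of double sequences *)

Lemma norm_limB_le (R : realType) (u : nat -> R) (l c r : R) :
  u k @[k --> \oo] --> l -> (\forall k \near \oo, `|u k - c| <= r) ->
  `|l - c| <= r.
Proof.
move=> ul ucr; apply: (@ler_cvg_to _ \oo _ R (fun k => `|u k - c|) (fun=> r)).
- by apply: cvg_norm; apply: cvgB => //; exact: cvg_cst.
- exact: cvg_cst.
- exact: ucr.
Qed.

Lemma geometric_steps (R : realType) (s : nat -> R) (j : nat) :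
  (forall N, (j <= N)%N -> `|s N.+1 - s N| <= 2^-1 ^+ N) ->
  forall N m, (j <= N <= m)%N -> `|s m - s N| <= 2 * 2^-1 ^+ N.
Proof.
move=> sj N m /andP[jN Nm]; rewrite -(subnKC Nm); move: (m - N)%N => {Nm}{}m.
suff : `|s (N + m)%N - s N| <= 2 * 2^-1 ^+ N - 2 * 2^-1 ^+ (N + m).
  have : 0 <= 2^-1 ^+ (N + m) :> R by rewrite exprn_ge0 ?invr_ge0.
  lra.
elim: m => [|m IH]; first by rewrite addn0 !subrr normr0.
have := sj _ (leq_trans jN (leq_addr m N)).
rewrite addnS exprS; move: IH; rewrite !ler_norml => /andP[? ?] /andP[? ?].
by apply/andP; split; lra.
Qed.

Lemma small_power (R : realType) (j : nat) (e : R) : 0 < e ->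
  exists2 N, (j <= N)%N & 2 * 2^-1 ^+ N < e.
Proof.
move=> e0; have e20 : 0 < e / 2 by rewrite divr_gt0.
have h1 : `|2^-1| < 1 :> R by rewrite ger0_norm; lra.
have /cvgrPdist_lt/(_ _ e20) H := cvg_expr h1.
near \oo => N; exists N; first by near: N; exact: nbhs_infty_ge.
have : `|0 - 2^-1 ^+ N| < e / 2 by near: N.
rewrite sub0r normrN ger0_norm ?exprn_ge0 ?invr_ge0//; lra.
Unshelve. all: by end_near. Qed.

(** The limits l N in k inherit the geometric bound on the steps, so they form
    a Cauchy sequence. For k beyond N, the diagonal term a k k is within
    2 * 2^-N of a N k, by a bound that does not depend on k; this is
    where the uniformity of the hypothesis in k is used. *)
Lemma cvg_diagonal (R : realType) (a : nat -> nat -> R) (l : nat -> R)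
    (j : nat) :
  (forall N, a N k @[k --> \oo] --> l N) ->
  (forall N k, (j <= N)%N -> `|a N.+1 k - a N k| <= 2^-1 ^+ N) ->
  cvgn l /\ a k k @[k --> \oo] --> limn l.
Proof.
move=> al aj.
have lj N : (j <= N)%N -> `|l N.+1 - l N| <= 2^-1 ^+ N.
  move=> jN; rewrite -[l N.+1 - l N]subr0.
  apply: (@norm_limB_le _ (fun k => a N.+1 k - a N k)); first exact: cvgB.
  by apply: nearW => k; rewrite subr0; exact: aj.
have lN := geometric_steps lj.
have lcvg : cvgn l.
  apply/cauchy_cvgP/cauchy_exP => e e0.
  have [N jN Ne] := small_power j e0.
  exists (l N); rewrite /nbhs /=; near=> m; rewrite /ball /= distrC.
  apply: le_lt_trans Ne; apply: lN; rewrite jN /=; near: m.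
  exact: nbhs_infty_ge.
split => //; apply/cvgrPdist_lt => e e0.
have e3 : 0 < e / 3 by rewrite divr_gt0.
have [N jN Ne] := small_power j e3.
have limN : `|limn l - l N| <= 2 * 2^-1 ^+ N.
  apply: norm_limB_le lcvg _; near=> m; apply: lN; rewrite jN /=; near: m.
  exact: nbhs_infty_ge.
near=> k.
have kN : `|a k k - a N k| <= 2 * 2^-1 ^+ N.
  apply: (geometric_steps (s := a ^~ k) (j := j)) => [M jM|]; first exact: aj.
  by rewrite jN /=; near: k; exact: nbhs_infty_ge.
have aN : `|l N - a N k| < e / 3.
  by near: k; have /cvgrPdist_lt := al N; apply.
move: kN limN aN; rewrite !ler_norml !ltr_norml.
move=> /andP[? ?] /andP[? ?] /andP[? ?]; apply/andP; split; lra.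
Unshelve. all: by end_near. Qed.

(** * Patching Baire 1 functions *)

(** The recursion, at one point of the space: c N is the value there of the
    N-th bump function and v N that of the N-th function. Where c N and
    c N.+2 are 1, the new value differs from the old one by a truncated
    increment; where c N is 0, it is c N.+2 * v N.+1. The bump attached
    to v N is c N.+1 and not c N, so that it is already 1 where c N is
    nonzero. *)
Fixpoint glue (R : realType) (c v : nat -> R) (N : nat) : R :=
  if N is M.+1 then
    c M * (glue c v M + clamp (2^-1 ^+ M) (v M.+1 - glue c v M))
    + (c M.+2 - c M) * v M.+1
  else c 1 * v 0.

(** The filter is arbitrary because the lemma serves twice: with the
    neighbourhoods of a point, for the continuity of the approximations, and
    along the integers, for their pointwise limit. *)
Lemma cvg_glue (R : realType) (T : Type) (F : set_system T) (FF : Filter F)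
    (c v : T -> nat -> R) (c' v' : nat -> R) :
  (forall n, c t n @[t --> F] --> c' n) ->
  (forall n, v t n @[t --> F] --> v' n) ->
  forall N, glue (c t) (v t) N @[t --> F] --> glue c' v' N.
Proof.
move=> cc' vv'; elim=> [|M IH] /=; first exact: cvgM.
apply: cvgD; apply: cvgM => //; last exact: cvgB.
by apply: cvgD => //; apply: cvg_clamp; exact: cvgB.
Qed.

(** When v moves by at most the truncation height wherever c does not vanish,
    the truncation in [glue] is without effect and the recursion merely changes
    the bump in front of v. *)
Lemma glueE (R : realType) (c v : nat -> R) :
  (forall n, c n != 0 -> c n.+1 = 1) ->
  (forall n, c n != 0 -> `|v n.+1 - v n| <= 2^-1 ^+ n) ->
  forall N, glue c v N = c N.+1 * v N.
Proof.
move=> c1 cv; elim=> [//|M IH] /=; rewrite IH.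
have [->|cM] := eqVneq (c M) 0; first by rewrite mul0r add0r subr0.
by rewrite (c1 _ cM) mul1r clamp_id ?cv //; ring.
Qed.

(** The rank j depends only on the bumps: the approximating values v, over
    which there is no control, are quantified after it. If c vanishes
    identically, so does [glue]; otherwise c is eventually 1, and then each step
    is a truncated increment. *)
Lemma glue_step (R : realType) (c : nat -> R) :
  (forall n, c n != 0 -> c n.+1 = 1) ->
  exists j, forall v N, (j <= N)%N ->
    `|glue c v N.+1 - glue c v N| <= 2^-1 ^+ N.
Proof.
move=> c1; have [[n cn]|c0] := pselect (exists n, c n != 0).
  have cS m : (n < m)%N -> c m = 1.
    elim: m => // m IH; rewrite ltnS leq_eqVlt => /predU1P[<-|/IH cm].
      exact: c1.
    by apply: c1; rewrite cm oner_neq0.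
  exists n.+1 => v N nN.
  rewrite /= (cS N) // (cS N.+2); last by rewrite ltnW // ltnW.
  rewrite subrr mul0r addr0 mul1r addrC addKr.
  by apply: norm_clamp_le; rewrite exprn_ge0 ?invr_ge0.
have {}c0 n : c n = 0 by apply/eqP; apply: contra_notT c0; exists n.
have g0 v N : glue c v N = 0.
  by case: N => [|N] /=; rewrite !c0 ?subrr !mul0r ?addr0.
by exists 0 => v N _; rewrite !g0 subrr normr0 exprn_ge0 ?invr_ge0.
Qed.

(** A sequence of Baire 1 functions that is uniformly Cauchy on the supports
    of a nested sequence of bumps has a limit there that extends to a Baire 1
    function on the whole space. The extension, the limit of chi_(n+1) f_n,
    is 0 where all the bumps vanish. *)
Lemma baire1_glue (R : realType) (X : topologicalType)
    (chi f : nat -> X -> R) :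
  (forall n, continuous (chi n)) ->
  (forall n x, chi n x != 0 -> chi n.+1 x = 1) ->
  (forall n, baire1 (f n)) ->
  (forall n x, chi n x != 0 -> `|f n.+1 x - f n x| <= 2^-1 ^+ n) ->
  exists2 g, baire1 g &
    forall n x, chi n x != 0 -> f m x @[m --> \oo] --> g x.
Proof.
move=> cchi chi1 Bf fS.
have /choice[u uP] n : exists u : nat -> X -> R,
    (forall k, continuous (u k)) /\ forall x, u k x @[k --> \oo] --> f n x.
  by have [u cu uf] := Bf n; exists u.
have key x : cvgn (fun N => chi N.+1 x * f N x) /\
    glue (chi ^~ x) (fun n => u n k x) k @[k --> \oo] -->
      limn (fun N => chi N.+1 x * f N x).
  have [j jP] := glue_step (chi1 ^~ x).
  apply: (@cvg_diagonal _ (fun N k => glue (chi ^~ x) (fun n => u n k x) N)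
    _ j); last by move=> N k; exact: jP.
  move=> N; rewrite -(glueE (chi1 ^~ x) (fS ^~ x)).
  apply: cvg_glue => n; first exact: cvg_cst.
  by have [_] := uP n; apply.
exists (fun x => limn (fun N => chi N.+1 x * f N x)).
  exists (fun k x => glue (chi ^~ x) (fun n => u n k x) k) => [k x|x].
    apply: cvg_glue => n; first exact: cchi.
    by have [+ _] := uP n; apply.
  by have [_] := key x.
move=> n x chin; have [+ _] := key x.
have cS m : (n <= m)%N -> chi m.+1 x = 1.
  elim: m => [|m IH].
    by rewrite leqn0 => /eqP n0; apply: chi1; rewrite -n0.
  rewrite leq_eqVlt => /predU1P[<-|/IH cm]; first exact: chi1.
  by apply: chi1; rewrite cm oner_neq0.
apply: cvg_trans; apply: near_eq_cvg; near=> m.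
rewrite cS ?mul1r //; near: m; exact: nbhs_infty_ge.
Unshelve. all: by end_near. Qed.

(** * Bump functions around compact sets *)

(** A property of sets that is local on a compact set holds for it, provided
    that it is inherited by subsets and finite unions. This is the extraction of
    a finite subcover: the sets with the property, ordered by inclusion,
    form the directed family to which the near-covering form of
    compactness is applied. *)
Lemma compact_ind (X : topologicalType) (P : set X -> Prop) :
  P set0 -> (forall A B, A `<=` B -> P B -> P A) ->
  (forall A B, P A -> P B -> P (A `|` B)) ->
  forall K, compact K -> (forall x, K x -> exists2 U, nbhs x U & P U) -> P K.
Proof.
move=> P0 Psub PU K /compact_near_coveringP cK Ploc.
pose F := filter_from P (fun B => [set C | P C /\ B `<=` C]).
have FF : Filter F.
  apply: filter_from_filter; first by exists set0.
  move=> A B PA PB; exists (A `|` B); first exact: PU.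
  by move=> C [PC]; rewrite subUset => -[].
have [|B PB] := cK (set X) F (fun C x => C x) FF.
  move=> x Kx; have [U Ux PU'] := Ploc x Kx.
  exists (U, [set C | P C /\ U `<=` C]).
    by split => //; exists U.
  by move=> [y C] [/= Uy [_]]; apply.
by move=> /(_ B (conj PB (@subset_refl _ B))) KB; apply: (Psub K B).
Qed.

(** Around a point, complete regularity gives such a function supported in a
    compact neighbourhood. In order to add finitely many of them, the condition
    to be 1 on K is relaxed to being at least 1, and the sum is truncated at
    the end. *)
Lemma compact_bump (R : realType) (X : topologicalType) (K : set X) :
  tychonoff_space X -> locally_compact [set: X] -> compact K ->
  exists (L : set X) (phi : X -> R), [/\ compact L, continuous phi,
    forall x, K x -> phi x = 1 & forall x, phi x != 0 -> L x].
Proof.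
move=> tX lcX cK; have [_ creg] := (tychonoff_spaceP R X).1 tX.
pose P (A : set X) := exists (L : set X) (phi : X -> R),
  [/\ compact L, continuous phi, forall x, 0 <= phi x,
      forall x, A x -> 1 <= phi x & forall x, phi x != 0 -> L x].
suff [L [phi [cL cphi _ phi1 phiL]]] : P K.
  exists L, (fun x => clamp 1 (phi x)); split => //.
  - by move=> x; apply: cvg_clamp; exact: cphi.
  - by move=> x /phi1 h; rewrite clamp_ge // ler01.
  - move=> x; have [->|/phiL//] := eqVneq (phi x) 0.
    by rewrite clamp_id ?eqxx // normr0.
apply: (compact_ind _ _ _ cK).
- exists set0, (fun=> 0); split => //; first exact: compact0.
    by move=> x; exact: cvg_cst.
  by move=> x; rewrite eqxx.
- move=> A B AB [L [phi [? ? ? phi1 ?]]]; exists L, phi; split => // x /AB.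
  exact: phi1.
- move=> A B [L [phi [cL cphi phi0 phi1 phiL]]].
  move=> [M [psi [cM cpsi psi0 psi1 psiM]]].
  exists (L `|` M), (fun x => phi x + psi x); split.
  + exact: compactU.
  + by move=> x; apply: cvgD; [exact: cphi|exact: cpsi].
  + by move=> x; rewrite addr_ge0.
  + move=> x [/phi1|/psi1] h; first by rewrite ler_wpDr.
    by rewrite ler_wpDl.
  + move=> x; have [->|/phiL ? _] := eqVneq (phi x) 0; last by left.
    by rewrite add0r => /psiM; right.
- move=> x Kx; have [N] := lcX x I.
  rewrite withinET => Nx [cN _].
  have /creg : closed (~` interior N).
    by apply: open_closedC; exact: open_interior.
  move=> /(_ x)[|f [cf f01 fx f1]]; first by apply; exact: Nx.
  exists [set y | f y < 2^-1].
    apply: (cvgr_lt (f x)); first exact: cf.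
    by rewrite fx invr_gt0.
  exists N, (fun y => 2 * (1 - f y)); split => //.
  + move=> y; apply: cvgM; first exact: cvg_cst.
    by apply: cvgB; [exact: cvg_cst|exact: cf].
  + move=> y; have := f01 (f y); rewrite /= in_itv /=.
    by move=> /(_ (ex_intro2 _ _ y I erefl)); lra.
  + by move=> y /=; lra.
  + move=> y; apply: contra_neqP => Ny.
    rewrite f1 ?subrr ?mulr0 // => Ny'; apply: Ny; exact: interior_subset Ny'.
Qed.

(** * The winning strategy *)

Lemma nbhs_baire1_UCP (X : topologicalType) (R : realType)
    (f : baire1_UC X R) (P : set (baire1_UC X R)) :
  nbhs f P <->
  exists (K : set X) (e : R), [/\ compact K, 0 < e &
    [set g : baire1_UC X R |
      forall x, K x -> `|\val f x - \val g x| < e] `<=` P].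
Proof.
split=> [|[K [e [cK e0 KeP]]]].
  rewrite nbhsE => -[_ [[B oB <-] Bf] BP].
  have /nbhs_family_compactP[K [e [cK e0 KeB]]] : nbhs (\val f) B.
    exact: open_nbhs_nbhs.
  by exists K, e; split => // g fg; apply: BP; exact: KeB.
apply: filterS KeP _.
have cval := @initial_continuous (baire1_UC X R) {family compact, X -> R}
  (fun g => \val g) f.
have := cval [set g : {family compact, X -> R} |
  forall x, K x -> `|\val f x - g x| < e]; apply.
by apply/nbhs_family_compactP; exists K, e; split.
Qed.

Theorem theorem3p5 (R : realType) (X : topologicalType) :
  tychonoff_space X -> locally_compact [set: X] ->
  strong_choquet (baire1_UC X R).
Proof.
move=> tX lcX.
pose Z := baire1_UC X R.
have /choice[ext extP] K : exists Lphi : set X * (X -> R),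
    compact K -> [/\ compact Lphi.1, continuous Lphi.2,
      forall x, K x -> Lphi.2 x = 1 & forall x, Lphi.2 x != 0 -> Lphi.1 x].
  have [cK|ncK] := pselect (compact K).
    by have [L [phi h]] := compact_bump R tX lcX cK; exists (L, phi).
  by exists (set0, fun=> 0).
have /choice[bas basP] (p : Z * set Z) : exists Ke : set X * R,
    [/\ compact Ke.1, 0 < Ke.2 & open p.2 -> p.2 p.1 ->
      [set g : Z | forall x, Ke.1 x -> `|\val p.1 x - \val g x| < Ke.2]
        `<=` p.2].
  case: p => f U /=; have [[oU Uf]|nU] := pselect (open U /\ U f).
    have /nbhs_baire1_UCP[K [e [cK e0 KeU]]] : nbhs f U.
      exact: open_nbhs_nbhs.
    by exists (K, e).
  exists (set0, 1); split => //; first exact: compact0.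
  by move=> oU Uf; exfalso; apply: nU.
pose stage (l : seq (Z * set Z)) : set X :=
  foldl (fun K p => (ext K).1 `|` (bas p).1) set0 l.
(* The halving leaves room for the limit, which satisfies the inequalities
   defining the answers only in the wide sense. *)
pose eps (p : Z * set Z) (n : nat) : R := Num.min (bas p).2 (2^-1 ^+ n) / 2.
pose answer : alpha_strategy Z := fun l =>
  if rev l is p :: s then
    interior [set g : Z | forall x, stage l x ->
      `|\val p.1 x - \val g x| < eps p (size s)]
  else setT.
exists answer => b.
pose f n : X -> R := \val (b n).1.
pose S n := stage (mkseq b n).
have SS n : S n.+1 = (ext (S n)).1 `|` (bas (b n)).1.
  by rewrite /S mkseqS /stage foldl_rcons.
have cS n : compact (S n).
  elim: n => [|n IH]; first exact: compact0.
  rewrite SS; apply: compactU; first by have [] := extP _ IH.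
  by have [] := basP (b n).
have eps0 n : 0 < eps (b n) n.
  rewrite divr_gt0 // lt_min exprn_gt0 ?invr_gt0 // andbT.
  by have [] := basP (b n).
have epsV n : eps (b n) n <= 2^-1 ^+ n.
  have : Num.min (bas (b n)).2 (2^-1 ^+ n) <= 2^-1 ^+ n.
    by rewrite ge_min lexx orbT.
  have : 0 < eps (b n) n by []; rewrite /eps; lra.
have epsb n : eps (b n) n < (bas (b n)).2.
  have : Num.min (bas (b n)).2 (2^-1 ^+ n) <= (bas (b n)).2.
    by rewrite ge_min lexx.
  have : 0 < eps (b n) n by []; rewrite /eps; lra.
have answerE n : alpha_answer answer b n = interior [set g : Z |
    forall x, S n.+1 x -> `|f n x - \val g x| < eps (b n) n].
  by rewrite /alpha_answer /answer mkseqS rev_rcons size_rev size_mkseq -mkseqS.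
have basU n (g : Z) : beta_legal answer b n ->
    (forall x, S n.+1 x -> `|f n x - \val g x| <= eps (b n) n) -> (b n).2 g.
  move=> [oU Uf _] fg; have [_ _] := basP (b n).
  move=> /(_ oU Uf); apply => x Lx; apply: le_lt_trans (epsb n).
  by apply: fg; rewrite SS; right.
have legal n : beta_legal answer b n -> alpha_legal answer b n.
  move=> bn; split; rewrite answerE; first exact: open_interior.
    apply/nbhs_baire1_UCP; exists (S n.+1), (eps (b n) n); split => //.
  apply: subset_trans (@interior_subset _ _) _ => g fg.
  by apply: basU => // x /fg /ltW.
split=> [n blegal|blegal]; first exact/legal/blegal.
have nested n m : (n < m)%N -> (b m).2 `<=` alpha_answer answer b n.
  elim: m => // m IH; rewrite ltnS leq_eqVlt => /predU1P[->|nm].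
    by have [_ _] := blegal m.+1; apply.
  apply: subset_trans (IH nm); have [_ _ /(_ m erefl) UV] := blegal m.+1.
  by have [_ _] := legal m (blegal m); exact: subset_trans.
have close n m x : (n < m)%N -> S n.+1 x -> `|f n x - f m x| < eps (b n) n.
  move=> nm; have [_ Ufm _] := blegal m.
  by have := nested n m nm _ Ufm; rewrite answerE => /interior_subset; apply.
have [||||g Bg fg] := @baire1_glue R X (fun n => (ext (S n)).2) f.
- by move=> n; have [] := extP _ (cS n).
- move=> n x chin; have [_ _ + _] := extP _ (cS n.+1); apply.
  by rewrite SS; left; have [_ _ _] := extP _ (cS n); apply.
- by move=> n; have := valP (b n).1; rewrite inE.
- move=> n x chin; rewrite distrC; apply: le_trans (epsV n).
  apply/ltW/close => //; rewrite SS; left.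
  by have [_ _ _] := extP _ (cS n); apply.
have fgS n x : S n x -> f m x @[m --> \oo] --> g x.
  move=> Sx; apply: (fg n); have [_ _ ext1 _] := extP _ (cS n).
  by rewrite ext1 // oner_neq0.
exists (exist _ g (mem_set Bg)) => n _.
(* The limit satisfies only wide inequalities for the n-th answer; it lies
   there because it lies in beta's next set. *)
apply: (nested n n.+1) => //; apply: basU => // x Sx /=.
rewrite distrC; apply: norm_limB_le (fgS n.+2 x Sx) _.
near=> m; rewrite distrC; apply/ltW/close => //; near: m.
exact: nbhs_infty_gt.
Unshelve. all: by end_near. Qed.
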